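(* Let $\beta>0$. Suppose $f\in S_{\beta}$ and the support of the measure $\mu_{\beta}$ representing $f$ in $S_\beta$ is compact. Then $\beta$ is the exact Stieltjes order of $f$, i.e. $\alpha^*[f]=\beta$.
   Context: For $\alpha>0$, $S_{\alpha}$ is the class of functions on $\mathbb{C}\setminus(-\infty,0]$ of the form $$f(z)=\int_{(0,\infty)}\frac{\mu_{\alpha}(du)}{(u+z)^{\alpha}}+\mu_{\infty}+\frac{\mu_0}{z^{\alpha}},$$ where $0\le\mu_0,\mu_\infty<\infty$ and $\mu_\alpha$ is a non-negative measure supported on $[0,\infty)$ with $\int_{[0,\infty)}(1+t)^{-\alpha}\mu_\alpha(dt)<\infty$; here $\mu_0=\mu_\alpha(\{0\})$. The branch of the power is the one positive on the positive half-axis; $\mu_\alpha$ (a measure on $[0,\infty)$, in which compactness of the support is understood) is called the measure representing $f$ in $S_\alpha$. $S_0$ is the set of non-negative constants, and $S_\infty=\bigcup_{\alpha>0}S_\alpha$. For $f\in S_\infty$ the exact Stieltjes order of $f$ is $\alpha^*[f]=\inf\{\alpha:\ f\in S_{\alpha}\}$.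
   Formalization: The representing measure is additionally assumed to be nonzero; if it is zero then f is a non-negative constant, its support is empty (hence compact), and the exact Stieltjes order is 0 rather than β. *)

(* Defs.v *)
From HB Require Import structures.
From mathcomp Require Import all_boot all_order all_algebra.
From mathcomp Require Import complex.
From mathcomp Require Import all_classical all_reals all_analysis.
Import Order.TTheory GRing.Theory Num.Theory.
Import numFieldNormedType.Exports.

Set Implicit Arguments.
Unset Strict Implicit.
Unset Printing Implicit Defensive.

Local Open Scope classical_set_scope.
Local Open Scope ring_scope.

Definition slit_plane (R : realType) : set R[i] :=
  [set z | ~ (complex.Im z = 0 /\ complex.Re z <= 0)].

(* Principal argument; on [slit_plane] it takes its values in ]-pi, pi[. *)
Definition carg (R : realType) (z : R[i]) : R :=
  let t := acos (complex.Re z / Normc.normc z) in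
  if 0 <= complex.Im z then t else - t.

(* Principal branch of z^a, i.e. |z|^a e^(i a arg z): it is positive on the
   positive half-axis. *)
Definition cpow (R : realType) (z : R[i]) (a : R) : R[i] :=
  Complex (Normc.normc z `^ a * cos (a * carg z))
          (Normc.normc z `^ a * sin (a * carg z)).

Definition Cintegral (R : realType)
    (mu : {measure set (measurableTypeR R) -> \bar R})
    (D : set R) (g : R -> R[i]) : R[i] :=
  Complex (Rintegral mu D (fun u => complex.Re (g u)))
          (Rintegral mu D (fun u => complex.Im (g u))).

(* Topological support. *)
Definition msupport (R : realType)
    (mu : {measure set (measurableTypeR R) -> \bar R}) : set R :=
  [set x | forall U : set R, open U -> U x -> (0 < mu U)%E].

(* [mu] represents [f] in S_alpha, for alpha > 0. Measures on [0, +oo[ are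
   encoded as Borel measures on the line for which ]-oo, 0[ is null.
   Only the values of [f] on [slit_plane] matter. The integrability condition
   makes [mu] finite on bounded sets, so that [fine] is harmless, and makes the
   complex integral absolutely convergent at every point of [slit_plane]. *)
Definition represents (R : realType) (alpha : R) (f : R[i] -> R[i])
    (mu : {measure set (measurableTypeR R) -> \bar R}) : Prop :=
  [/\ mu `]-oo, 0[%classic = 0%E,
      (\int[mu]_(t in `[0%R, +oo[) ((1 + t) `^ (- alpha))%:E < +oo)%E
    & exists2 mu_infty : R, 0 <= mu_infty &
      forall z, slit_plane z ->
        f z = Cintegral mu `]0, +oo[%classic
                (fun u => (cpow (Complex u 0 + z) alpha)^-1)
              + Complex mu_infty 0
              + Complex (fine (mu [set 0])) 0 / cpow z alpha].

Definition stieltjes_class (R : realType) (alpha : R) (f : R[i] -> R[i]) : Prop :=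
  (alpha = 0 /\ exists2 c : R, 0 <= c &
     forall z, slit_plane z -> f z = Complex c 0)
  \/ (0 < alpha /\ exists mu, represents alpha f mu).

(* Meaningful when [f] belongs to some S_alpha; the set is then nonempty and
   bounded below by 0. *)
Definition exact_stieltjes_order (R : realType) (f : R[i] -> R[i]) : R :=
  inf [set alpha : R | stieltjes_class alpha f].

(* Main.v *)
Require Import Defs.
From HB Require Import structures.
From mathcomp Require Import all_boot all_order all_algebra.
From mathcomp Require Import complex.
From mathcomp Require Import all_classical all_reals all_analysis.
From mathcomp Require Import measurable_realfun ring.
Import Order.TTheory GRing.Theory Num.Theory.
Import numFieldNormedType.Exports.
Local Open Scope classical_set_scope.
Local Open Scope ring_scope.

(** Only the values of [f] on the real half-line [x >= 1] are
    needed. There a function represented by [mu] at order [a] is a constant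
    plus the transform [T x], the integral of [(u + x)^(-a)] over [0, +oo[
    against [mu]. The transform tends to [0] as [x] grows
    ([stieltjes_transform_cvg0], by dominated convergence), so the constant is
    the limit of [f] at infinity and does not depend on the representation.
    Hence, if [f] is also in S_a for some [0 < a < beta], represented by [nu],
    the transforms of [mu] at order [beta] and of [nu] at order [a] coincide
    on [1, +oo[.

    They cannot decay at the same rate. A compactly supported [mu] is carried
    by some [0, M], so its transform is at most [mu [0, M] * x^(-beta)]
    ([stieltjes_transform_upper]). The measure [nu] is not zero on [0, +oo[,
    because the common transform is positive; so its transform is at least
    [nu [0, N] * (N + x)^(-a)], where [N] is such that [nu [0, N] > 0]
    ([stieltjes_transform_lower]). For [a < beta] the second bound eventually
    exceeds the first ([powR_growth_contra]). When [a = 0] the function is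
    constant and equal to its limit, so the transform of [mu] would vanish,
    although the lower bound makes it positive because [mu] is nonzero.

    Thus [beta] is a lower bound of the set of admissible orders, to which it
    also belongs. *)

Set Implicit Arguments.
Unset Strict Implicit.
Unset Printing Implicit Defensive.

Section Transform.
Variable R : realType.
Implicit Types (mu nu : {measure set (measurableTypeR R) -> \bar R}).

(** * The Stieltjes transform on the positive half-axis *)

Definition stieltjes_transform (a : R) mu (x : R) : \bar R :=
  (\int[mu]_(u in `[0%R, +oo[) ((u + x) `^ (- a))%:E)%E.

Lemma measurable_kernel (a x : R) (D : set (measurableTypeR R)) :
  measurable_fun D (EFin \o (fun u => (u + x) `^ (- a))
    : measurableTypeR R -> \bar R).
Proof.
apply/measurable_EFinP; apply: (@measurable_funTS _ _ _ _ D).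
apply: (@measurableT_comp _ _ _ _ _ _ (fun v : R => v `^ (- a))).
  exact: measurable_powR.
exact: measurable_realfun.measurable_funD.
Qed.

Lemma kernel_ge0 (a x u : R) : (0%:E <= ((u + x) `^ (- a))%:E)%E.
Proof. by rewrite lee_fin powR_ge0. Qed.

Lemma le_powRN (a x y : R) : 0 <= a -> 0 < x -> x <= y ->
  y `^ (- a) <= x `^ (- a).
Proof.
move=> a0 x0 xy; have y0 := lt_le_trans x0 xy.
by rewrite !powRN lef_pV2 ?posrE ?powR_gt0// ge0_ler_powR// nnegrE ltW.
Qed.

Lemma stieltjes_transform_le (a : R) mu (x y : R) : 0 <= a -> 0 < x -> x <= y ->
  (stieltjes_transform a mu y <= stieltjes_transform a mu x)%E.
Proof.
move=> a0 x0 xy; apply: ge0_le_integral => //.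
- by move=> u _; exact: kernel_ge0.
- exact: measurable_kernel.
- exact: measurable_kernel.
- move=> u /=; rewrite in_itv/= andbT => u0; rewrite lee_fin le_powRN//.
    by rewrite ltr_wpDl.
  by rewrite lerD2l.
Qed.

Lemma stieltjes_transform_fin (a : R) mu (x : R) : 0 <= a -> 1 <= x ->
  (stieltjes_transform a mu 1 < +oo)%E ->
  stieltjes_transform a mu x \is a fin_num.
Proof.
move=> a0 x1 fin1; rewrite ge0_fin_numE.
  by apply: le_lt_trans fin1; exact: stieltjes_transform_le.
by apply: integral_ge0 => u _; exact: kernel_ge0.
Qed.

Lemma powRN_cvg0 (a u : R) : 0 < a ->
  (u + n.+1%:R) `^ (- a) @[n --> \oo] --> (0 : R).
Proof.
move=> a0; apply/cvgrPdist_lt => e e0.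
have b0 : 0 < e^-1 `^ a^-1 by rewrite powR_gt0 ?invr_gt0.
near=> n; rewrite sub0r normrN ger0_norm ?powR_ge0//.
have bn : e^-1 `^ a^-1 < u + n.+1%:R.
  rewrite -ltrBlDl; apply: (@lt_le_trans _ _ n%:R); last by rewrite ler_nat.
  by near: n; exact: nbhs_infty_gtr.
have n0 := lt_trans b0 bn.
rewrite powRN -[ltRHS]invrK ltf_pV2 ?posrE ?invr_gt0 ?powR_gt0//.
have -> : e^-1 = (e^-1 `^ a^-1) `^ a.
  by rewrite -powRrM mulVf ?gt_eqF// powRr1// invr_ge0 ltW.
by rewrite gt0_ltr_powR// nnegrE ltW.
Unshelve. all: by end_near. Qed.

(** The kernel at [x = 1] dominates the kernels at all larger integers, and it
    is integrable by the assumption on [mu]. *)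
Lemma stieltjes_transform_cvg0 (a : R) mu : 0 < a ->
  (stieltjes_transform a mu 1 < +oo)%E ->
  stieltjes_transform a mu n.+1%:R @[n --> \oo] --> 0%E.
Proof.
move=> a0 fin1.
rewrite -(integral0 mu `[0%R, +oo[).
apply: (@dominated_cvg _ _ _ _ _ _ _ _
  (EFin \o (fun u => (u + 1) `^ (- a)) : measurableTypeR R -> \bar R)) => //.
- by move=> n; exact: measurable_kernel.
- by move=> u _; apply: cvg_EFin; [exact: nearW|exact: powRN_cvg0].
- apply/integrableP; split; first exact: measurable_kernel.
  under eq_integral do rewrite /= ger0_norm ?powR_ge0//.
  exact: fin1.
- move=> n u /=; rewrite in_itv/= andbT => u0.
  rewrite ger0_norm ?powR_ge0// lee_fin le_powRN//; first exact: ltW.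
    by rewrite ltr_wpDl.
  by rewrite lerD2l ler1n.
Qed.

(** On [0, N] the kernel is smallest at [u = N], and dropping the part of the
    integral beyond [N] only decreases it. *)
Lemma stieltjes_transform_lower (a : R) mu (N x : R) : 0 <= a -> 0 < x ->
  (((N + x) `^ (- a))%:E * mu `[0%R, N]%classic <=
    stieltjes_transform a mu x)%E.
Proof.
move=> a0 x0.
rewrite -integral_cst//.
apply: (@le_trans _ _ (\int[mu]_(u in `[0%R, N]) ((u + x) `^ (- a))%:E)%E).
  apply: ge0_le_integral => //.
  - by move=> u _; exact: kernel_ge0.
  - exact: measurable_kernel.
  - move=> u /=; rewrite in_itv/= => /andP[u0 uN]; rewrite lee_fin le_powRN//.
      by rewrite ltr_wpDl.
    by rewrite lerD2r.
apply: ge0_subset_integral => //.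
- exact: measurable_kernel.
- by move=> u _; exact: kernel_ge0.
- by move=> u /=; rewrite !in_itv/= andbT => /andP[].
Qed.

(** In [stieltjes_transform_lower] at [x = 1] there is a positive factor in
    front of the mass of [0, N], so infinite mass would make the transform
    infinite. *)
Lemma bounded_mass_fin (a : R) mu (N : R) : 0 < a -> 0 <= N ->
  (stieltjes_transform a mu 1 < +oo)%E -> mu `[0%R, N]%classic \is a fin_num.
Proof.
move=> a0 N0 fin1; rewrite ge0_fin_numE//.
have p0 : 0 < (N + 1) `^ (- a) by apply: powR_gt0; rewrite ltr_wpDl.
have := le_lt_trans (stieltjes_transform_lower mu N (ltW a0) (@ltr01 R)) fin1.
rewrite !ltey; apply: contra => /eqP ->.
by rewrite gt0_muley ?lte_fin.
Qed.

(** On [0, M] the kernel is largest at [u = 0], and nothing is lost by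
    truncating the integral at [M]. *)
Lemma stieltjes_transform_upper (a : R) mu (M x : R) : 0 <= a -> 0 < x ->
  mu `]M, +oo[%classic = 0%E ->
  (stieltjes_transform a mu x <= (x `^ (- a))%:E * mu `[0%R, M]%classic)%E.
Proof.
move=> a0 x0 M0.
have null : mu (`[0%R, +oo[%classic `&` `]M, +oo[%classic) = 0%E.
  apply/eqP; rewrite -measure_le0 -M0 le_measure ?inE//.
  exact: measurableI.
have E : `[0%R, +oo[%classic =
    `[0%R, M]%classic `|` (`[0%R, +oo[%classic `&` `]M, +oo[%classic).
  apply/seteqP; split => u /=; rewrite !in_itv/= !andbT.
    by move=> u0; case: (leP u M) => uM; [left; rewrite u0|right].
  by case=> [/andP[]|[]].
rewrite /stieltjes_transform [in leLHS]E.
rewrite ge0_integral_setU//; last first.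
  rewrite disj_set2E; apply/eqP/seteqP; split => // u [] /=.
  by rewrite !in_itv/= !andbT => /andP[_ uM] [_]; rewrite ltNge => /negP.
- by move=> u _; exact: kernel_ge0.
- exact: measurable_kernel.
- exact: measurableI.
rewrite [X in (_ + X)%E]null_set_integral//; last 2 first.
- exact: measurableI.
- exact: measurable_kernel.
rewrite adde0 -integral_cst//.
apply: ge0_le_integral => //.
- by move=> u _; exact: kernel_ge0.
- exact: measurable_kernel.
- move=> u /=; rewrite in_itv/= => /andP[u0 uM]; rewrite lee_fin le_powRN//.
  by rewrite lerDr.
Qed.

(** * Mass and support *)

Lemma exists_bounded_mass mu : mu `[0%R, +oo[%classic <> 0%E ->
  exists N : nat, (0 < mu `[0%R, N%:R]%classic)%E.
Proof.
move=> mu0; apply: contrapT => /forallNP nopos; apply: mu0.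
apply/(negligibleP mu) => //.
rewrite itv_bndy_bigcup_BRight; apply: negligible_bigcup => k.
apply/negligibleP => //; apply/eqP; rewrite -measure_le0 leNgt; apply/negP.
by rewrite add0r; exact: nopos.
Qed.

(** By definition each point off the support has a null neighbourhood, which can
    be shrunk to a ball with rational centre and radius; countably many such
    null balls therefore cover [A]. *)
Lemma msupport_compl_null mu (A : set R) :
  measurable (A : set (measurableTypeR R)) ->
  A `&` msupport mu = set0 -> mu A = 0%E.
Proof.
move=> mA A0; apply/(negligibleP mu) => //.
(* The null rational balls, enumerated by codes of (centre, radius), with the
   empty set at the codes of nothing or of a ball of positive measure. *)
pose F k : set R :=
  if unpickle k is Some (c, r) then
    let B := ball (ratr c : R) (ratr r) in if mu B == 0%E then B else set0
  else set0.
have FN k : mu.-negligible (F k).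
  rewrite /F; case: (unpickle k) => [[c r]|]; last exact: negligible_set0.
  case: eqP => [e|_]; last exact: negligible_set0.
  by apply/negligibleP => //; exact: measurable_ball.
apply: negligibleS (negligible_bigcup FN) => x Ax.
have : ~ msupport mu x by move=> sx; have : set0 x by rewrite -A0.
move/existsNP => [U /not_implyP[oU /not_implyP[Ux /negP]]].
rewrite -leNgt measure_le0 => /eqP U0.
have [|c [r /= [xB BU]]] := @open_subball_rat R U x oU; first by rewrite inE.
exists (pickle (c, r)); first exact: I.
rewrite /F pickleK.
rewrite inE in xB.
rewrite ifT// -measure_le0 -U0 le_measure ?inE//.
  exact: measurable_ball.
exact: open_measurable.
Qed.

Lemma compact_support_bound mu : compact (msupport mu) ->
  exists2 M : R, 0 <= M & mu `]M, +oo[%classic = 0%E.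
Proof.
move=> /compact_bounded[M [_ HM]]; exists (`|M| + 1); first by rewrite addr_ge0.
apply: msupport_compl_null => //.
apply/seteqP; split => // u [] /=; rewrite in_itv/= andbT => Mu su.
have := HM (`|M| + 1); rewrite ltr_pwDr ?ler_norm// => /(_ isT u su) /=.
by move=> /(le_trans (ler_norm u)); rewrite leNgt Mu.
Qed.

(** * Real values of represented functions *)

Lemma cpow_posreal (x a : R) : 0 < x ->
  cpow (Complex x 0) a = Complex (x `^ a) 0.
Proof.
move=> x0.
have nx : Normc.normc (Complex x 0) = x.
  by rewrite /= expr0n/= addr0 sqrtr_sqr gtr0_norm.
have ax : carg (Complex x 0) = 0.
  by rewrite /carg nx/= lexx divff ?gt_eqF// acos1.
by rewrite /cpow nx ax mulr0 cos0 sin0 mulr1 mulr0.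
Qed.

Lemma complex_realV (x : R) : (Complex x 0)^-1 = Complex x^-1 0.
Proof. exact: esym (fmorphV (real_complex R) x). Qed.

(** Representations integrate over ]0, +oo[ and write the contribution of the
    mass at [0] as a separate term; the transform gathers both. *)
Lemma stieltjes_transform_split (a : R) mu (x : R) : 0 < x ->
  stieltjes_transform a mu x =
    (\int[mu]_(u in `]0%R, +oo[) ((u + x) `^ (- a))%:E
     + (x `^ (- a))%:E * mu [set 0%R])%E.
Proof.
move=> x0.
have E : (`[0%R, +oo[%classic : set R) = `]0%R, +oo[%classic `|` [set 0%R].
  apply/seteqP; split => u /=; rewrite !in_itv/= !andbT.
    by rewrite le_eqVlt => /predU1P[<-|]; [right|left].
  by case=> [/ltW|->].
rewrite /stieltjes_transform [in LHS]E ge0_integral_setU//.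
- congr (_ + _)%E.
  rewrite -integral_cst//; apply: eq_integral => u.
  by rewrite inE/= => ->; rewrite add0r.
- exact: measurable_kernel.
- by move=> u _; exact: kernel_ge0.
- rewrite disj_set2E; apply/eqP/seteqP; split => // u [] /=.
  by rewrite in_itv/= andbT => /[swap] ->; rewrite ltxx.
Qed.

(** Only [x >= 1] is considered, because the integrability condition in a
    representation is the finiteness of the transform at [x = 1], and the
    transform is nonincreasing. *)
Lemma represents_posreal (a : R) (f : R[i] -> R[i]) mu : 0 < a ->
  represents a f mu ->
  (stieltjes_transform a mu 1 < +oo)%E /\
  exists c : R, forall x, 1 <= x ->
    complex.Re (f (Complex x 0)) = fine (stieltjes_transform a mu x) + c.
Proof.
move=> a0 [_ fin1 [c _ fE]].
have {}fin1 : (stieltjes_transform a mu 1 < +oo)%E.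
  by rewrite /stieltjes_transform; under eq_integral do rewrite addrC.
split => //; exists c => x x1.
have x0 : 0 < x := lt_le_trans ltr01 x1.
have finx : stieltjes_transform a mu x \is a fin_num.
  by apply: stieltjes_transform_fin => //; exact: ltW.
rewrite fE; last by move=> [_] /=; rewrite leNgt x0.
rewrite cpow_posreal// complex_realV.
have -> : Cintegral mu `]0, +oo[%classic
      (fun u => (cpow (Complex u 0 + Complex x 0) a)^-1)
  = Complex (fine (\int[mu]_(u in `]0%R, +oo[) ((u + x) `^ (- a))%:E)) 0.
  have kE u : 0 < u -> (cpow (Complex u 0 + Complex x 0) a)^-1 =
      Complex ((u + x) `^ (- a)) 0.
    move=> u0; have -> : Complex u 0 + Complex x 0 = Complex (u + x) 0.
      by rewrite -[RHS]/(real_complex R (u + x)) rmorphD.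
    by rewrite cpow_posreal ?addr_gt0// complex_realV powRN.
  rewrite /Cintegral /Rintegral; congr (Complex (fine _) _).
    apply: eq_integral => u; rewrite inE/= in_itv/= andbT => u0.
    exact: (congr1 EFin (congr1 (@complex.Re R) (kE u u0))).
  rewrite integral0_eq// => u /=; rewrite in_itv/= andbT => u0.
  exact: (congr1 EFin (congr1 (@complex.Im R) (kE u u0))).
have fm : mu [set 0%R] \is a fin_num.
  have := stieltjes_transform_fin (ltW a0) (lexx _) fin1.
  by rewrite stieltjes_transform_split// powR1 mul1e fin_numD => /andP[].
move: finx; rewrite stieltjes_transform_split//.
rewrite fin_numD => /andP[fI fM].
rewrite (fineD fI fM) fineM//= !mulr0 subr0 -powRN; ring.
Qed.

(** The additive constant is recovered from the function alone, which is what
    lets two representations of the same function be compared. *)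
Lemma represents_posreal_cvg (a : R) mu (F : R -> R) (c : R) : 0 < a ->
  (stieltjes_transform a mu 1 < +oo)%E ->
  (forall x, 1 <= x -> F x = fine (stieltjes_transform a mu x) + c) ->
  F n.+1%:R @[n --> \oo] --> c.
Proof.
move=> a0 fin1 FE.
under eq_fun do rewrite FE ?ler1n//.
have T0 : fine (stieltjes_transform a mu n.+1%:R) @[n --> \oo] --> (0 : R).
  exact/fine_cvg/stieltjes_transform_cvg0.
by have := cvgD T0 (cvg_cst c); rewrite add0r; apply.
Qed.

(** * Comparison of decay rates *)

(** Once [x >= N], the left-hand side is at least [c * (2 x)^(-a)], so the
    inequality would bound [x^(b - a)] by [C / (c * 2^(-a))]. *)
Lemma powR_growth_contra (a b c C N : R) : 0 <= a -> a < b -> 0 < c -> 0 <= C ->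
  0 <= N ->
  ~ (forall x, 1 <= x -> c * (N + x) `^ (- a) <= C * x `^ (- b)).
Proof.
move=> a0 ab c0 C0 N0 H.
have d0 : 0 < b - a by rewrite subr_gt0.
have c'0 : 0 < c * 2 `^ (- a) by rewrite mulr_gt0 ?powR_gt0.
pose K := C / (c * 2 `^ (- a)) + 1.
have K0 : 0 < K by rewrite ltr_wpDl// divr_ge0// ltW.
pose y := K `^ (b - a)^-1.
have y0 : 0 < y by rewrite powR_gt0.
(* [x >= N + 1] makes [N + x <= 2 x], and [x >= y] makes [x^(b - a)] at least
   [K], which exceeds the bound [C / (c * 2^(-a))]. *)
pose x := N + 1 + y.
have x1 : 1 <= x by rewrite /x addrAC lerDr addr_ge0// ltW.
have x0 : 0 < x := lt_le_trans ltr01 x1.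
have Kx : K <= x `^ (b - a).
  have -> : K = y `^ (b - a) by rewrite -powRrM mulVf ?gt_eqF// powRr1// ltW.
  apply: (ge0_ler_powR (ltW d0)); rewrite ?nnegrE ?(ltW y0) ?(ltW x0)//.
  by rewrite /x lerDr addr_ge0.
have Nx : (2 * x) `^ (- a) <= (N + x) `^ (- a).
  apply: le_powRN => //; first by rewrite ltr_wpDl.
  by rewrite mulr_natl mulr2n lerD2r /x -addrA lerDl addr_ge0// ltW.
have := le_trans (ler_wpM2l (ltW c0) Nx) (H x x1).
rewrite powRM ?(ltW x0)// mulrA.
have -> : x `^ (- a) = x `^ (b - a) * x `^ (- b).
  rewrite -powRD; last by rewrite (gt_eqF x0) implybT.
  by congr (_ `^ _); ring.
rewrite mulrA ler_pM2r ?powR_gt0//.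
apply/negP; rewrite -ltNge.
apply: (@lt_le_trans _ _ (c * 2 `^ (- a) * K)); last by rewrite ler_pM2l.
by rewrite /K mulrDr mulr1 mulrC divfK ?gt_eqF// ltrDl.
Qed.

(** For [a > 0], two representations of [f], of orders [b] and [a], have equal
    transforms for [x >= 1], since their constants are both the limit of [f] at
    infinity; the decay rates then force [b <= a]. For [a = 0] the same limit
    shows that the transform of [mu] is zero at [1], against its positivity. *)
Lemma stieltjes_order_lower_bound (a b : R) (f : R[i] -> R[i]) mu : 0 < b ->
  represents b f mu -> mu [set: R] <> 0%E -> compact (msupport mu) ->
  stieltjes_class a f -> b <= a.
Proof.
move=> b0 fmu mu0 cmu.
have [mun _ _] := fmu.
have [fin1 [c FE]] := represents_posreal b0 fmu.
have Fcvg := represents_posreal_cvg b0 fin1 FE.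
have [M M0 muM] := compact_support_bound cmu.
have [N muN] : exists N : nat, (0 < mu `[0%R, N%:R]%classic)%E.
  apply: exists_bounded_mass => mup; apply: mu0.
  apply/(negligibleP mu) => //.
  rewrite -(setUv (`]-oo, 0%R[%classic : set R)) setCitvl.
  by apply: negligibleU; apply/(negligibleP mu).
have Tpos x : 0 < x -> (0 < stieltjes_transform b mu x)%E.
  move=> x0; apply: lt_le_trans (stieltjes_transform_lower _ N%:R (ltW b0) x0).
  by rewrite mule_gt0// lte_fin powR_gt0// ltr_wpDl.
case=> [[-> [d _ fd]]|[a0 [nu fnu]]].
  have slit x : 1 <= x -> slit_plane (Complex x 0 : R[i]).
    by move=> x1 [_] /=; rewrite leNgt (lt_le_trans ltr01 x1).
  have fd1 x : 1 <= x -> complex.Re (f (Complex x 0)) = d.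
    by move=> /slit/fd ->.
  have dc : c = d.
    apply: (cvg_unique _ Fcvg) => //=.
    under eq_fun do rewrite fd1 ?ler1n//.
    exact: cvg_cst.
  have := FE 1 (lexx _); rewrite fd1// dc => /esym/eqP.
  rewrite -subr_eq0 addrK fine_eq0 ?stieltjes_transform_fin//; last exact: ltW.
  by move=> /eqP T0; have := Tpos 1 ltr01; rewrite T0 ltxx.
have [fin1' [c' FE']] := represents_posreal a0 fnu.
have cc' : c = c'.
  by apply: (cvg_unique _ Fcvg (represents_posreal_cvg a0 fin1' FE')).
have TE x : 1 <= x -> stieltjes_transform b mu x = stieltjes_transform a nu x.
  move=> x1; have := FE x x1; rewrite FE'// cc' => /addIr TE.
  rewrite -[LHS]fineK ?stieltjes_transform_fin ?(ltW b0)// -TE fineK//.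
  by rewrite stieltjes_transform_fin ?(ltW a0).
rewrite leNgt; apply/negP => ab.
have [N' nuN] : exists N : nat, (0 < nu `[0%R, N%:R]%classic)%E.
  apply: exists_bounded_mass => nup; have := Tpos 1 ltr01.
  rewrite TE// /stieltjes_transform null_set_integral ?ltxx//.
  exact: measurable_kernel.
have mufin : mu `[0%R, M]%classic \is a fin_num.
  exact: bounded_mass_fin b0 M0 fin1.
have nufin : nu `[0%R, N'%:R]%classic \is a fin_num.
  exact: bounded_mass_fin a0 _ fin1'.
apply: (@powR_growth_contra a b (fine (nu `[0%R, N'%:R]%classic))
  (fine (mu `[0%R, M]%classic)) N'%:R) => //.
- exact: ltW.
- by rewrite fine_gt0// nuN ltey_eq nufin.
move=> x x1; have x0 : 0 < x := lt_le_trans ltr01 x1.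
rewrite -lee_fin !EFinM !fineK//.
rewrite muleC; apply: le_trans (stieltjes_transform_lower _ _ (ltW a0) x0) _.
by rewrite -TE// muleC; exact: stieltjes_transform_upper (ltW b0) x0 muM.
Qed.

End Transform.

Theorem corollary2 (R : realType) (beta : R) (f : R[i] -> R[i])
    (mu : {measure set (measurableTypeR R) -> \bar R})
    (beta_gt0 : 0 < beta)
    (f_in_Sbeta : stieltjes_class beta f)
    (mu_repr : represents beta f mu)
    (mu_neq0 : mu [set: R] <> 0%E)
    (supp_compact : compact (msupport mu)) :
  exact_stieltjes_order f = beta.
Proof.
have lb : lbound [set alpha : R | stieltjes_class alpha f] beta.
  by move=> alpha; exact: stieltjes_order_lower_bound mu_repr _ _.
apply/eqP; rewrite eq_le; apply/andP; split.
  by apply: ge_inf => //; exists beta.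
by apply: lb_le_inf => //; exists beta.
Qed.
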